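(* Let $\alpha > 1$ be a real number. The equation $$1 + \sum_{k=1}^{\infty} \frac{2^k}{(1-\alpha)(1-\alpha^2)\cdots(1-\alpha^k)} = 0$$ is satisfied if and only if $\alpha = 2^{1/n}$ for some positive integer $n$.
   Context: The parameter $\alpha$ is real with $\alpha>1$; the infinite series converges absolutely in this case. The denominator of the $k$-th term is the product $\prod_{j=1}^{k}(1-\alpha^j)$. *)

(* Defs.v *)
From HB Require Import structures.
From mathcomp Require Import all_boot all_order all_algebra.
From mathcomp Require Import all_classical all_reals all_analysis.
Set Implicit Arguments.
Unset Strict Implicit.
Unset Printing Implicit Defensive.
Import Order.TTheory GRing.Theory Num.Theory.
Import numFieldNormedType.Exports.
Local Open Scope classical_set_scope.
Local Open Scope ring_scope.

(* An infinite sum is [limn] of its partial sums, a total operator that is only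
   meaningful when these converge. The series at hand converges absolutely for
   every [alpha > 1]: by [alpha ^+ j - 1 >= (alpha - 1) *+ j], its terms are
   dominated by those of the exponential series. *)
Lemma abs_cvg_term (R : realType) (alpha : R) : 1 < alpha ->
  cvgn [normed series (fun k : nat =>
          2 ^+ k / \prod_(1 <= j < k.+1) (1 - alpha ^+ j))].
Proof.
move=> a1; have x0 : 0 < alpha - 1 by rewrite subr_gt0.
have bern j : (alpha - 1) *+ j <= alpha ^+ j - 1.
  elim: j => [|j IH]; first by rewrite mulr0n expr0 subrr.
  rewrite mulrSr exprS.
  have -> : alpha * alpha ^+ j - 1 =
            (alpha ^+ j - 1) + (alpha - 1) * alpha ^+ j.
    by rewrite mulrBl mul1r [RHS]addrC addrA subrK.
  by apply: lerD => //; apply: ler_peMr; [exact: ltW | exact: exprn_ege1 (ltW a1)].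
have prod_ge k : (alpha - 1) ^+ k * k`!%:R <=
                 `|\prod_(1 <= j < k.+1) (1 - alpha ^+ j)|.
  elim: k => [|k IH].
    by rewrite big_geq// expr0 mul1r fact0 normr1.
  rewrite big_nat_recr//= normrM exprSr factS mulnC natrM mulrACA.
  apply: ler_pM => //.
  - by rewrite mulr_ge0 ?exprn_ge0 ?ler0n ?ltW.
  - by rewrite mulr_ge0 ?ler0n ?ltW.
  - by rewrite distrC mulr_natr (le_trans (bern _))// ler_norm.
apply: (@series_le_cvg R _ (exp_coeff (2 / (alpha - 1)))) => [k|k|k|].
- exact: normr_ge0.
- by rewrite exp_coeff_ge0// divr_ge0 ?ltW.
- rewrite /exp_coeff /= normrM normfV ger0_norm ?exprn_ge0//.
  rewrite expr_div_n -mulrA -invfM ler_pM2l ?exprn_gt0//.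
  have gt0 : 0 < (alpha - 1) ^+ k * k`!%:R.
    by rewrite mulr_gt0 ?exprn_gt0// ltr0n fact_gt0.
  by rewrite lef_pV2 ?prod_ge// posrE (lt_le_trans gt0).
- exact: is_cvg_series_exp_coeff.
Qed.

(* Main.v *)
Require Import Defs.
From HB Require Import structures.
From mathcomp Require Import all_boot all_order all_algebra.
From mathcomp Require Import all_classical all_reals all_analysis.
From mathcomp Require Import ring.
Import Order.TTheory GRing.Theory Num.Theory.
Import numFieldNormedType.Exports.
Local Open Scope classical_set_scope.
Local Open Scope ring_scope.

(* Put [f z = 1 + sum_(k >= 1) z^k / ((1 - alpha) ... (1 - alpha^k))]. Comparing
   coefficients, [f z = (1 - z / alpha) * f (z / alpha)], hence
   [f 2 = (1 - 2 / alpha) ... (1 - 2 / alpha^n) * f (2 / alpha^n)]. As [f] is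
   continuous at [0] with [f 0 = 1], the last factor is nonzero for large [n]. *)

Section PowerSeries.
Context {R : realType}.
Variable a : R^nat.
Hypothesis abs_a : cvgn [normed series a].

Lemma is_cvg_pseries (r : R) : `|r| <= 1 ->
  cvgn (series (fun k => a k * r ^+ k)).
Proof.
move=> r1; apply: normed_cvg; apply: series_le_cvg abs_a => k //=.
by rewrite normrM normrX ler_piMr// exprn_ile1.
Qed.

(** Quantitative continuity at 0: every term of index [k >= 1] carries a factor [r], and the
    remaining power of [r] has absolute value at most 1. *)
Lemma pseries_sub0_le (r : R) : `|r| <= 1 ->
  `|limn (series (fun k => a k * r ^+ k)) - a 0| <= `|r| * limn [normed series a].
Proof.
move=> r1; have cF := is_cvg_pseries _ r1.
have cG : (fun n => `|series (fun k => a k * r ^+ k) n - a 0|) @ \oo -->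
    `|limn (series (fun k => a k * r ^+ k)) - a 0|.
  by apply: cvg_norm; apply: cvgB => //; exact: cvg_cst.
rewrite -(cvg_lim _ cG)//; apply: limr_le; first by apply/cvg_ex; eexists; exact: cG.
(* Only a nonempty partial sum contains the term of index 0, which cancels [a 0]. *)
near=> n; have n0 : (0 < n)%N by near: n; exact: nbhs_infty_gt.
have le_M : [normed series a] n <= limn [normed series a].
  apply: nondecreasing_cvgn_le abs_a _.
  by apply: nondecreasing_series => k _ _; exact: normr_ge0.
apply: le_trans (ler_wpM2l (normr_ge0 r) le_M).
rewrite /series /= big_ltn// expr0 mulr1 addrAC subrr add0r.
rewrite [X in _ <= _ * X]big_ltn// mulrDr mulr_sumr.
apply: le_trans (ler_norm_sum _ _ _) _.
rewrite ler_wpDl ?mulr_ge0//.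
rewrite big_nat_cond [leRHS]big_nat_cond; apply: ler_sum => k /andP[/andP[k0 _] _].
rewrite normrM normrX mulrC ler_wpM2r//.
by case: k k0 => // k _; rewrite exprS ler_piMr// exprn_ile1.
Unshelve. all: by end_near. Qed.

(** A zero value at [q ^+ n] would force [|a 0| <= q ^+ n * M] by the previous bound, which fails
    once [q ^+ n] is small. *)
Lemma pseries_near0_neq0 (q : R) : 0 < q < 1 -> a 0 != 0 ->
  \forall n \near \oo, limn (series (fun k => a k * (q ^+ n) ^+ k)) != 0.
Proof.
move=> /andP[q0 q1] a0; set M := limn [normed series a].
have qM : (fun n => q ^+ n * M) @ \oo --> (0 : R).
  rewrite -[X in _ --> X](mul0r M); apply: cvgM; last exact: cvg_cst.
  by apply: cvg_expr; rewrite gtr0_norm.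
have a0_gt0 : 0 < `|a 0| by rewrite normr_gt0.
near=> n.
have qnM : q ^+ n * M < `|a 0|.
  have : `|q ^+ n * M| < `|a 0|.
    by near: n; exact: (cvgr0_norm_lt _ qM).
  by apply: le_lt_trans; exact: ler_norm.
have qn : `|q ^+ n| = q ^+ n by rewrite ger0_norm// exprn_ge0// ltW.
have qn1 : `|q ^+ n| <= 1 by rewrite qn exprn_ile1// ltW.
apply/eqP => F0; have := pseries_sub0_le _ qn1.
rewrite qn F0 sub0r normrN leNgt qnM.
Unshelve. all: by end_near. Qed.

End PowerSeries.

Section Product.
Context {R : realType}.
Variable alpha : R.
Hypothesis alpha_gt1 : 1 < alpha.

(** Index 0 has an empty product, so [term 0 = 1] supplies the leading 1 of the equation. *)
Let term (k : nat) : R := 2 ^+ k / \prod_(1 <= j < k.+1) (1 - alpha ^+ j).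

(* In the notation of the header, [F n = f (2 / alpha ^+ n)]. *)
Let F (n : nat) : R := limn (series (fun k => term k * (alpha^-1 ^+ n) ^+ k)).

Let alpha_gt0 : 0 < alpha. Proof. exact: lt_trans alpha_gt1. Qed.

Let alphaV01 : 0 < alpha^-1 < 1.
Proof. by rewrite invr_gt0 alpha_gt0 invf_lt1. Qed.

Let cvg_F n : series (fun k => term k * (alpha^-1 ^+ n) ^+ k) @ \oo --> F n.
Proof.
apply: is_cvg_pseries; first exact: abs_cvg_term.
have /andP[q0 q1] := alphaV01.
by rewrite normrX exprn_ile1// gtr0_norm// ltW.
Qed.

Let term_rec k : (1 - alpha ^+ k.+1) * term k.+1 = 2 * term k.
Proof.
have k0 : 1 - alpha ^+ k.+1 != 0.
  by rewrite subr_eq0 eq_sym gt_eqF// exprn_egt1.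
by rewrite /term big_nat_recr//= invfM mulrC !mulrA divfK// exprS.
Qed.

Let F_rec n : F n = (1 - 2 * alpha^-1 ^+ n.+1) * F n.+1.
Proof.
pose S m N := series (fun k => term k * (alpha^-1 ^+ m) ^+ k) N.
(* Multiplying by the argument raises degrees by one. With the last sum one term shorter, the
   functional equation holds exactly for partial sums. *)
have S_rec N : S n N.+1 = S n.+1 N.+1 - 2 * alpha^-1 ^+ n.+1 * S n.+1 N.
  rewrite /S /series /= !big_nat_recl// -addrA !expr0 mulr_sumr; congr (_ + _).
  rewrite -sumrB; apply: eq_bigr => k _.
  set b := _ ^+ n.+1.
  (* The two terms of degree [k.+1] now differ by the factor [alpha ^+ k.+1], so [term_rec] applies
     to their difference. *)
  have -> : alpha^-1 ^+ n = alpha * b by rewrite /b exprS mulVKf// gt_eqF.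
  by rewrite [2 * b * _]mulrACA -term_rec -exprS exprMn; ring.
have : (fun N => S n N.+1) @ \oo -->
    F n.+1 - 2 * alpha^-1 ^+ n.+1 * F n.+1.
  under eq_fun do rewrite S_rec.
  apply: cvgB; first by rewrite (cvg_shiftS (S n.+1)); exact: cvg_F.
  by apply: cvgM; [exact: cvg_cst|exact: cvg_F].
rewrite (cvg_shiftS (S n)) mulrBl mul1r => cS.
by rewrite -(cvg_lim (@Rhausdorff R) cS) (cvg_lim (@Rhausdorff R) (cvg_F n)).
Qed.

Lemma euler_series_eq0 : F 0 = 0 <-> exists2 n, (0 < n)%N & alpha ^+ n = 2.
Proof.
have factor0 n : (1 - 2 * alpha^-1 ^+ n == 0) = (alpha ^+ n == 2).
  have an0 : alpha ^+ n != 0 by rewrite expf_neq0// gt_eqF.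
  by rewrite subr_eq0 exprVn -(inj_eq (mulIf an0)) mul1r divfK.
have F_prod n : F 0 = (\prod_(1 <= j < n.+1) (1 - 2 * alpha^-1 ^+ j)) * F n.
  elim: n => [|n IH]; first by rewrite big_geq// mul1r.
  by rewrite big_nat_recr//= -mulrA -F_rec.
split=> [F00|[n n0 an]]; last first.
  apply/eqP; rewrite (F_prod n) mulf_eq0 prodf_seq_eq0; apply/orP; left.
  by apply/hasP; exists n; rewrite ?mem_index_iota ?n0 ?ltnSn// factor0 an eqxx.
have term0 : term 0 != 0 by rewrite /term big_geq// expr0 divr1 oner_neq0.
(* For this [n] the tail factor [F n] is nonzero, so some factor of the finite product vanishes; its
   index [j] is the exponent sought. *)
have /filter_ex[n Fn] :=
  pseries_near0_neq0 _ (abs_cvg_term alpha_gt1) _ alphaV01 term0.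
move/eqP: F00; rewrite (F_prod n) mulf_eq0 (negbTE Fn) orbF prodf_seq_eq0.
by move=> /hasP[j]; rewrite mem_index_iota factor0 => /andP[j0 _] /eqP; exists j.
Qed.

End Product.

Theorem lemma1 (R : realType) (alpha : R) (alpha_gt1 : 1 < alpha) :
  1 + limn (fun N : nat => \sum_(1 <= k < N.+1)
              (2 ^+ k / \prod_(1 <= j < k.+1) (1 - alpha ^+ j))) = 0
  <-> exists n : nat, (0 < n)%N /\ alpha = 2 `^ (1 / n%:R).
Proof.
have alpha_ge0 : 0 <= alpha by exact: ltW (lt_trans _ alpha_gt1).
have rootE n : (0 < n)%N -> alpha ^+ n = 2 <-> alpha = 2 `^ (1 / n%:R).
  move=> n0; have nR : n%:R != 0 :> R by rewrite pnatr_eq0 -lt0n.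
  split=> [<-|->]; rewrite -powR_mulrn ?powR_ge0// -powRrM.
    by rewrite mul1r divff// powRr1.
  by rewrite mul1r mulVf// powRr1.
set u : nat -> R := fun k => 2 ^+ k / \prod_(1 <= j < k.+1) (1 - alpha ^+ j).
(* The leading 1 is absorbed as [u 0]; [series u N.+1] covers the indices 0 to [N], hence the
   shift. *)
have -> : 1 + limn (fun N : nat => \sum_(1 <= k < N.+1) u k) = limn (series u).
  have cu : cvgn (series u) by exact: normed_cvg (abs_cvg_term alpha_gt1).
  have u0 : u 0 = 1 by rewrite /u big_geq// expr0 divr1.
  have E N : \sum_(1 <= k < N.+1) u k = series u N.+1 - 1.
    by rewrite /series /= [in RHS]big_ltn// u0 addrAC subrr add0r.
  under eq_fun do rewrite E.
  suff /cvg_lim -> : (fun N => series u N.+1 - 1) @ \oo --> limn (series u) - 1.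
  - by rewrite addrC subrK.
  - exact: Rhausdorff.
  by apply: cvgB; [rewrite (cvg_shiftS (series u))|exact: cvg_cst].
(* The inserted factor equals 1 and gives the series the shape of [F 0]. *)
have -> : series u = series (fun k => u k * (alpha^-1 ^+ 0) ^+ k).
  by congr series; apply/funext => k; rewrite expr0 expr1n mulr1.
rewrite (euler_series_eq0 _ alpha_gt1).
by split=> [[n n0 /(rootE n n0) an]|[n [n0 /(rootE n n0) an]]]; exists n.
Qed.
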